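(* Let $n\ge1$ and let $V_{\mathbb R}$ be a real vector space of dimension $4n$. The period domain $Compl=\{I\in\mathrm{End}\,V_{\mathbb R}\mid I^2=-Id\}$ is $\mathbb H(\varepsilon)$-connected for $\varepsilon=-1$ and for $\varepsilon=1$.
   Context: For $\varepsilon\in\{-1,0,1\}$, $\mathbb H(\varepsilon)=\langle i,j\mid i^2=-1,\ j^2=\varepsilon,\ ij+ji=0\rangle$ is the corresponding $4$-dimensional real (unital, associative) algebra. A (generalized) twistor line of type $\mathbb H(\varepsilon)$ is the image in $Compl$ of the set of imaginary units (elements with square $-1$) of $\mathbb H(\varepsilon)$ under a faithful (unital) representation $\mathbb H(\varepsilon)\to\mathrm{End}\,V_{\mathbb R}$. $Compl$ (with its topology as a subset of $\mathrm{End}\,V_{\mathbb R}$) has two connected components. $Compl$ is called $\mathbb H(\varepsilon)$-connected if any two points $x,y$ in the same connected component of $Compl$ can be connected by a path (chain) of connected components of twistor lines of type $\mathbb H(\varepsilon)$, i.e. there is a finite sequence $C_1,\dots,C_m$, each $C_l$ a connected component of a twistor line of type $\mathbb H(\varepsilon)$, with $x\in C_1$, $y\in C_m$ and $C_l\cap C_{l+1}\neq\emptyset$ for $1\le l<m$. *)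

(* Defs.v *)
From HB Require Import structures.
From mathcomp Require Import all_boot all_order all_algebra.
From mathcomp Require Import ring.
From mathcomp Require Import all_classical all_reals all_analysis.
Import numFieldNormedType.Exports.

Set Implicit Arguments.
Unset Strict Implicit.
Unset Printing Implicit Defensive.

Import Order.TTheory GRing.Theory Num.Theory passmx.

Local Open Scope classical_set_scope.
Local Open Scope ring_scope.

(* H eps = < i, j | i ^ 2 = -1, j ^ 2 = eps, i j + j i = 0 >, with the
   quadruple (a, b, c, d) standing for a + b i + c j + d i j. *)
Record H (R : comNzRingType) (eps : R) :=
  mkH { hre : R; hi : R; hj : R; hij : R }.

Arguments mkH {R eps}.

Section Algebra.
Variables (R : comNzRingType) (eps : R).
Implicit Types p q r : H eps.

Definition H_tuple q := (hre q, hi q, hj q, hij q).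
Definition tuple_H (t : R * R * R * R) : H eps :=
  mkH t.1.1.1 t.1.1.2 t.1.2 t.2.

Lemma H_tupleK : cancel H_tuple tuple_H. Proof. by case. Qed.

HB.instance Definition _ := Choice.copy (H eps) (can_type H_tupleK).

Definition H_zero : H eps := mkH 0 0 0 0.
Definition H_opp q : H eps := mkH (- hre q) (- hi q) (- hj q) (- hij q).
Definition H_add p q : H eps :=
  mkH (hre p + hre q) (hi p + hi q) (hj p + hj q) (hij p + hij q).

Lemma H_addA : associative H_add.
Proof. by move=> [? ? ? ?] [? ? ? ?] [? ? ? ?]; congr mkH; apply: addrA. Qed.

Lemma H_addC : commutative H_add.
Proof. by move=> [? ? ? ?] [? ? ? ?]; congr mkH; apply: addrC. Qed.

Lemma H_add0 : left_id H_zero H_add.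
Proof. by move=> [? ? ? ?]; congr mkH; apply: add0r. Qed.

Lemma H_addN : left_inverse H_zero H_opp H_add.
Proof. by move=> [? ? ? ?]; congr mkH; apply: addNr. Qed.

HB.instance Definition _ :=
  GRing.isZmodule.Build (H eps) H_addA H_addC H_add0 H_addN.

Definition H_one : H eps := mkH 1 0 0 0.

(* The multiplication table forced by the relations, with k = i j:
     i i = -1,  j j = eps,       k k = eps,
     i j = k,   j k = - eps i,   k i = j,
     j i = - k, k j = eps i,     i k = - j. *)
Definition H_mul p q : H eps :=
  mkH
    (hre p * hre q - hi p * hi q + eps * (hj p * hj q) + eps * (hij p * hij q))
    (hre p * hi q + hi p * hre q - eps * (hj p * hij q) + eps * (hij p * hj q))
    (hre p * hj q + hj p * hre q - hi p * hij q + hij p * hi q)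
    (hre p * hij q + hij p * hre q + hi p * hj q - hj p * hi q).

Lemma H_mulA : associative H_mul.
Proof. by move=> [? ? ? ?] [? ? ? ?] [? ? ? ?]; congr mkH => /=; ring. Qed.

Lemma H_mul1l : left_id H_one H_mul.
Proof. by move=> [? ? ? ?]; congr mkH => /=; ring. Qed.

Lemma H_mul1r : right_id H_one H_mul.
Proof. by move=> [? ? ? ?]; congr mkH => /=; ring. Qed.

Lemma H_mulDl : left_distributive H_mul +%R.
Proof. by move=> [? ? ? ?] [? ? ? ?] [? ? ? ?]; congr mkH => /=; ring. Qed.

Lemma H_mulDr : right_distributive H_mul +%R.
Proof. by move=> [? ? ? ?] [? ? ? ?] [? ? ? ?]; congr mkH => /=; ring. Qed.

Lemma H_one_neq0 : H_one != 0.
Proof. by apply/eqP => -[] /eqP; rewrite oner_eq0. Qed.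

HB.instance Definition _ := GRing.Zmodule_isNzRing.Build (H eps)
  H_mulA H_mul1l H_mul1r H_mulDl H_mulDr H_one_neq0.

Definition H_scale (a : R) q : H eps :=
  mkH (a * hre q) (a * hi q) (a * hj q) (a * hij q).

Lemma H_scaleA a b q : H_scale a (H_scale b q) = H_scale (a * b) q.
Proof. by congr mkH; apply: mulrA. Qed.

Lemma H_scale1 : left_id 1 H_scale.
Proof. by move=> [? ? ? ?]; congr mkH; apply: mul1r. Qed.

Lemma H_scaleDr : right_distributive H_scale +%R.
Proof. by move=> ? [? ? ? ?] [? ? ? ?]; congr mkH; apply: mulrDr. Qed.

Lemma H_scaleDl q : {morph H_scale^~ q : a b / a + b}.
Proof. by move=> ? ?; congr mkH; apply: mulrDl. Qed.

HB.instance Definition _ := GRing.Zmodule_isLmodule.Build R (H eps)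
  H_scaleA H_scale1 H_scaleDr H_scaleDl.

Lemma H_scaleAl (a : R) p q : a *: (p * q) = (a *: p) * q.
Proof. by congr mkH => /=; ring. Qed.

Lemma H_scaleAr (a : R) p q : a *: (p * q) = p * (a *: q).
Proof. by congr mkH => /=; ring. Qed.

HB.instance Definition _ :=
  GRing.Lmodule_isLalgebra.Build R (H eps) H_scaleAl.
HB.instance Definition _ := GRing.Lalgebra_isAlgebra.Build R (H eps) H_scaleAr.

Definition H_i : H eps := mkH 0 1 0 0.
Definition H_j : H eps := mkH 0 0 1 0.

Lemma H_i_sqr : H_i * H_i = -1.
Proof. by congr mkH => /=; ring. Qed.

Lemma H_j_sqr : H_j * H_j = eps%:A.
Proof. by congr mkH => /=; ring. Qed.

Lemma H_ijC : H_i * H_j + H_j * H_i = 0.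
Proof. by congr mkH => /=; ring. Qed.

Lemma H_basisE q :
  q = hre q *: 1 + hi q *: H_i + hj q *: H_j + hij q *: (H_i * H_j).
Proof. by case: q => a b c d; congr mkH => /=; ring. Qed.

Definition imaginary_units : set (H eps) := [set q | q * q = -1].

End Algebra.

Arguments imaginary_units {R} eps.

(* The usual topology of the finite dimensional real vector space 'Hom(V, W),
   read off on matrices; it does not depend on the bases used. *)
HB.instance Definition _ (R : realType) (V W : vectType R) :=
  Topological.copy 'Hom(V, W)
    (initial_topology (mxof (vbasis (fullv : {vspace V}))
                            (vbasis (fullv : {vspace W})))).

Section Twistor.
Variables (R : realType) (V : vectType R).

Definition Compl : set 'End(V) := [set I | (I \o I)%VF = - \1%VF].

Definition faithful_representation (eps : R) (rho : H eps -> 'End(V)) : Prop :=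
  [/\ linear rho,
      rho 1 = \1%VF,
      forall p q, rho (p * q) = (rho p \o rho q)%VF
    & injective rho].

Definition twistor_line (eps : R) (S : set 'End(V)) : Prop :=
  exists2 rho : H eps -> 'End(V),
    faithful_representation rho & S = rho @` (imaginary_units eps).

Definition twistor_line_component (eps : R) (C : set 'End(V)) : Prop :=
  exists S : set 'End(V), twistor_line eps S /\
    exists2 x, S x & C = connected_component S x.

Definition H_path (eps : R) (x y : 'End(V)) : Prop :=
  exists (m : nat) (C : nat -> set 'End(V)),
    [/\ forall l, (l <= m)%N -> twistor_line_component eps (C l),
        C 0%N x,
        C m y
      & forall l, (l < m)%N -> C l `&` C l.+1 !=set0].

Definition H_connected (eps : R) : Prop :=
  forall x y : 'End(V), Compl x -> Compl y ->
    connected_component Compl x y -> H_path eps x y.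

End Twistor.

Arguments Compl {R} V.
Arguments H_path {R} V eps x y.
Arguments H_connected {R} V eps.

(* Main.v *)
Require Import Defs.
From mathcomp Require Import all_boot all_order all_algebra.
From mathcomp Require Import ring lra.
From mathcomp Require Import all_classical all_reals all_analysis.
From Stdlib Require Import Relations.
Import numFieldNormedType.Exports.

Set Implicit Arguments.
Unset Strict Implicit.
Unset Printing Implicit Defensive.

Import Order.TTheory GRing.Theory Num.Theory passmx.

Local Open Scope classical_set_scope.
Local Open Scope ring_scope.

(** Being joined by a chain of components of twistor lines is an equivalence
relation on [Compl]. The proof shows that its classes are open; then they are
also closed, and a connected component of [Compl] lies in a single class.

If [x] and [y] are complex structures, then [g = 1 - y x] satisfies
[g x = y g]. Hence [y = g x g^-1] as soon as [\det g != 0], and the [y] with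
[\det (1 - y x) > 0] form a neighbourhood of [x] in [Compl] (for [y = x] one has
[g = 2]). So it is enough to show that [x] is equivalent to [g x g^-1] whenever
[\det g > 0] ([stab_det_gt0]). For fixed [x] these [g] form a group [S]
([twistor_stab]), because conjugation maps twistor lines to twistor lines, and
[S] contains the centralizer of [x].

The key fact is [twistor_equiv_nilpotent]. Let [N] anticommute with [x], with
[N^2 = 0], and let [K] be a partner of the same kind with [N K + K N = 1]. Then
[J = (eps / c) N + c K] satisfies [J^2 = eps] and anticommutes with [x], while
[N J + J N = c]. Therefore [z = a x + b J] lies on a twistor line through [x], and
[(x + N) z + z (x + N)] is again a scalar, so that [z] and [x + N] lie on a
common twistor line too. The scalar [c] is free, and it is chosen so that both
lines have type [eps] and the points lie on the same sheet. The argument is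
uniform in [eps]; the only input is a pair of points of the conic
[a^2 - eps b^2 = 1].

The dimension being divisible by 4, [x] can be written as [diag(I, I)] with [I]
complex and of even size. The key fact puts into [S] the unipotent matrices
[[1, P], [0, 1]] with [P] invertible and antilinear; sums of two such [P] give all
antilinear [P], the centralizer gives the linear ones, and together these are all
real [P]. Such block-unipotent matrices, with their transposes, generate all
transvections ([upper_lower_transvection]), hence all matrices of determinant 1
([transvection_generate]); scalars commute with [x] and take care of the other
positive determinants. *)

(** * Twistor lines and nilpotent perturbations, in matrices *)

(** Identities between linear combinations of matrices: the products that occur
have to be turned into atoms first, since [mxE] expands them otherwise. *)
Ltac mxlin := apply/matrixP => ? ?; rewrite !mxE; ring.

(** The conic consists of the imaginary units [a i + b j] of [H eps], and
[0 <= a] singles out one sheet of the hyperboloid when [eps = 1]. The point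
[(a, b)] locates an intermediate complex structure with respect to [X], and
[(a', b')] with respect to a perturbation of [X]; [a != a'] is what allows this
perturbation to be nonzero. *)
Definition two_conic_points (R : rcfType) (eps : R) : Prop :=
  exists a b a' b' : R,
  [/\ b != 0, b' != 0, a != a', 0 <= a /\ 0 <= a' &
      a ^+ 2 - eps * b ^+ 2 = 1 /\ a' ^+ 2 - eps * b' ^+ 2 = 1].

Section Steps.
Variables (R : rcfType) (eps : R) (N : nat).
Implicit Types X Y Z J A B g : 'M[R]_N.

Lemma mulmx_comb X J (a b : R) :
  (a *: X + b *: J) *m (a *: X + b *: J) =
  a ^+ 2 *: (X *m X) + (a * b) *: (X *m J + J *m X) + b ^+ 2 *: (J *m J).
Proof.
rewrite !mulmxDl !mulmxDr -!scalemxAl -!scalemxAr !scalerA scalerDr.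
by rewrite (mulrC b a) -!expr2 !addrA.
Qed.

(** [X] and [J] generate a twistor line, and the condition [0 <= a] keeps [Y] in
the component of [X]: the arc with [b] growing from 0 joins the two
([twistor_step_share]). *)
Definition twistor_step X Y : Prop := exists J a b,
  [/\ X *m X = - 1%:M, J *m J = eps%:M, X *m J + J *m X = 0,
      Y = a *: X + b *: J & a ^+ 2 - eps * b ^+ 2 = 1 /\ 0 <= a].

Lemma twistor_step_sqr X Y : twistor_step X Y -> Y *m Y = - 1%:M.
Proof.
case=> J [a [b [XX JJ XJ -> [ab _]]]].
rewrite mulmx_comb XX JJ XJ -[eps%:M]scalemx1 -[in RHS](scale1r 1%:M) -ab.
mxlin.
Qed.

(** Two complex structures with scalar anticommutator lie on a common twistor
line: the component of [Y] orthogonal to [X] is a multiple of a suitable [J]. *)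
Lemma twistor_stepP X Y (a b : R) :
    X *m X = - 1%:M -> Y *m Y = - 1%:M -> X *m Y + Y *m X = (- a *+ 2)%:M ->
    b != 0 -> a ^+ 2 - eps * b ^+ 2 = 1 -> 0 <= a -> twistor_step X Y.
Proof.
move=> XX YY XY b0 ab a0.
have JE : b^-1 *: (Y - a *: X) = (- a / b) *: X + b^-1 *: Y by mxlin.
exists (b^-1 *: (Y - a *: X)), a, b; split => //.
- have epsE : eps = (a ^+ 2 - 1) / b ^+ 2.
    by apply: (canRL (mulfK _)); rewrite ?expf_neq0// -ab; ring.
  rewrite JE mulmx_comb XX YY XY -[_%:M in LHS]scalemx1 -[eps%:M]scalemx1 epsE.
  by apply/matrixP => i j; rewrite !mxE; field.
- rewrite JE !mulmxDl !mulmxDr -!scalemxAl -!scalemxAr XX.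
  rewrite addrACA -[_ *: (X *m Y) + _]scalerDr XY -scalemx1.
  by apply/matrixP => i j; rewrite !mxE; ring.
- rewrite scalerA mulfV// scale1r; mxlin.
Qed.

Lemma twistor_step_conj g X Y : g \in unitmx -> twistor_step X Y ->
  twistor_step (g *m X *m invmx g) (g *m Y *m invmx g).
Proof.
move=> gu [J [a [b [XX JJ XJ -> ab]]]].
have cM A B : g *m A *m invmx g *m (g *m B *m invmx g) =
               g *m (A *m B) *m invmx g.
  by rewrite !mulmxA mulmxKV.
have cs (c : R) : g *m c%:M *m invmx g = c%:M.
  by rewrite scalar_mxC mulmxK.
exists (g *m J *m invmx g), a, b; split => //.
- by rewrite cM XX mulmxN mulNmx cs.
- by rewrite cM JJ cs.
- by rewrite !cM -mulmxDl -mulmxDr XJ mulmx0 mul0mx.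
- by rewrite mulmxDr mulmxDl -!scalemxAr -!scalemxAl.
Qed.

Definition twistor_equiv : relation 'M[R]_N := clos_refl_sym_trans _ twistor_step.

Lemma twistor_equiv_conj g X Y : g \in unitmx -> twistor_equiv X Y ->
  twistor_equiv (g *m X *m invmx g) (g *m Y *m invmx g).
Proof.
move=> gu; elim=> {X Y} [X Y XY|X|X Y _|X Y Z _ XY _ YZ].
- by apply: rst_step; apply: twistor_step_conj.
- exact: rst_refl.
- exact: rst_sym.
- exact: rst_trans XY YZ.
Qed.

(** The intermediate point is [Z = a X + b J] with
[J = (eps / c) M + c K]; since [M J + J M = c], passing from [X] to [X + M]
changes the anticommutator with [Z] from [- 2 a] to [- 2 a + b c], which the
choice of [c] makes equal to [- 2 a']. *)
Lemma twistor_equiv_nilpotent X M K : two_conic_points eps ->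
  X *m X = - 1%:M -> M *m M = 0 -> K *m K = 0 -> M *m K + K *m M = 1%:M ->
  X *m M + M *m X = 0 -> X *m K + K *m X = 0 ->
  twistor_equiv X (X + M).
Proof.
case=> a [b [a' [b' [b0 b'0 aa' [a0 a'0] [ab ab']]]]] XX NN KK NK XN XK.
pose c : R := (a - a') *+ 2 / b.
have c0 : c != 0 by rewrite mulf_neq0 ?invr_eq0// mulrn_eq0/= subr_eq0.
pose J := (eps / c) *: M + c *: K.
have JJ : J *m J = eps%:M.
  rewrite /J mulmx_comb NN KK NK !scaler0 add0r addr0 divfK//.
  by rewrite scalemx1.
have XJ : X *m J + J *m X = 0.
  rewrite /J mulmxDr mulmxDl -!scalemxAl -!scalemxAr addrACA -!scalerDr XN XK.
  by rewrite !scaler0 addr0.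
have NJ : M *m J + J *m M = c%:M.
  rewrite /J mulmxDr mulmxDl -!scalemxAl -!scalemxAr addrACA -!scalerDr NN NK.
  by rewrite addr0 scaler0 add0r scalemx1.
pose Z := a *: X + b *: J.
have XZ : twistor_step X Z by exists J, a, b.
have YY : (X + M) *m (X + M) = - 1%:M.
  by rewrite mulmxDl !mulmxDr NN addr0 -addrA XN addr0.
apply: rst_trans (rst_step _ _ _ _ XZ) _; apply/rst_sym/rst_step.
apply: (twistor_stepP YY (twistor_step_sqr XZ) _ b'0 ab' a'0).
rewrite /Z !mulmxDl !mulmxDr -!scalemxAl -!scalemxAr XX.
have -> : J *m X = - (X *m J).
  by apply/eqP; rewrite -addr_eq0 addrC XJ.
have -> : M *m X = - (X *m M).
  by apply/eqP; rewrite -addr_eq0 addrC XN.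
have -> : J *m M = c%:M - M *m J by rewrite -NJ addrAC subrr add0r.
have bc : - a' *+ 2 = - a *+ 2 + b * c by rewrite /c mulrC divfK//; ring.
rewrite bc -[_%:M in RHS]scalemx1 -[c%:M]scalemx1; move: (X *m M) (X *m J) => U W.
mxlin.
Qed.
End Steps.

(** * Generation of the special linear group by transvections *)

Definition upper (R : pzRingType) p q (P : 'M[R]_(p, q)) : 'M[R]_(p + q) :=
  block_mx 1%:M P 0 1%:M.
Definition lower (R : pzRingType) p q (P : 'M[R]_(q, p)) : 'M[R]_(p + q) :=
  block_mx 1%:M 0 P 1%:M.

Section Generation.
Variable F : fieldType.

Lemma cV_dual k (v : 'cV[F]_k) : v != 0 -> exists w : 'rV[F]_k, w *m v = 1%:M.
Proof.
move=> v0; have : row_free v^T by rewrite -row_leq_rank lt0n mxrank_eq0 trmx_eq0.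
case/row_freeP => w vw; exists w^T; apply: trmx_inj.
by rewrite trmx_mul trmxK vw trmx1.
Qed.

(** A transvection whose column lies in the upper half is, up to an upper
unipotent factor, [diag(1 + r1 s1, 1)] with [s1 r1 = 0], and this is a commutator
of an upper and a lower unipotent matrix. Conjugation by a lower unipotent matrix
clears the lower half of any column whose upper half is nonzero, and conjugation
by an upper one makes the upper half nonzero. *)
Lemma upper_lower_transvection p (S : 'M[F]_(p.+1 + p.+1) -> Prop) :
    (forall g h, S g -> S h -> S (g *m h)) ->
    (forall P, S (upper P)) -> (forall P, S (lower P)) ->
  forall (r : 'cV_(p.+1 + p.+1)) (s : 'rV_(p.+1 + p.+1)),
  s *m r = 0 -> S (1%:M + r *m s).
Proof.
move=> SM SU SL.
have S1 : S 1%:M by rewrite (scalar_mx_block p.+1 p.+1 1); apply: SU.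
have Sdiag (r1 : 'cV_p.+1) (s1 : 'rV_p.+1) : s1 *m r1 = 0 ->
    S (block_mx (1%:M + r1 *m s1) 0 0 1%:M).
  (* e pads r1 and s1 to square matrices r0, s0 with r0 s0 = r1 s1, s0 r0 = 0 *)
  move=> sr; pose e : 'rV[F]_p.+1 := delta_mx 0 0.
  pose r0 := r1 *m e; pose s0 := e^T *m s1.
  have ee : e *m e^T = 1%:M.
    by rewrite trmx_delta mul_delta_mx [RHS]mx11_scalar mxE [LHS]mx11_scalar mxE.
  have rs : r0 *m s0 = r1 *m s1 by rewrite /r0 /s0 !mulmxA -(mulmxA r1) ee mulmx1.
  have sr0 : s0 *m r0 = 0 by rewrite /r0 /s0 !mulmxA -(mulmxA _ s1) sr mulmx0 mul0mx.
  have -> : block_mx (1%:M + r1 *m s1) 0 0 1%:M =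
      lower (- s0) *m upper r0 *m lower s0 *m upper (- r0).
    rewrite /lower /upper !mulmx_block !(mulmx0, mul0mx, mul1mx, mulmx1, addr0, add0r).
    rewrite !mulNmx sr0 oppr0 add0r mul1mx addNr mul0mx add0r -rs.
    by rewrite mulmxN mulmxDl mul1mx -mulmxA sr0 mulmx0 addr0 addNr.
  by apply: (SM) => //; apply: (SM) => //; apply: (SM).
have Stop (r : 'cV_(p.+1 + p.+1)) (s : 'rV_(p.+1 + p.+1)) :
    s *m r = 0 -> usubmx r != 0 -> S (1%:M + r *m s).
  rewrite -[r]vsubmxK -[s]hsubmxK col_mxKu.
  move: (usubmx r) (dsubmx r) (lsubmx s) (rsubmx s) => r1 r2 s1 s2.
  rewrite mul_row_col => sr /cV_dual[w wr].
  (* lower q kills the lower half of the column *)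
  have [q qr] : exists q, q *m r1 = - r2.
    by exists (- r2 *m w); rewrite -mulmxA wr mulmx1.
  have sr' : (s1 - s2 *m q) *m r1 = 0.
    by rewrite mulmxBl -mulmxA qr mulmxN opprK.
  have -> : 1%:M + col_mx r1 r2 *m row_mx s1 s2 =
    lower (- q) *m (upper (r1 *m s2) *m
      block_mx (1%:M + r1 *m (s1 - s2 *m q)) 0 0 1%:M) *m lower q.
    rewrite mul_col_row (scalar_mx_block p.+1 p.+1 1) add_block_mx.
    rewrite /lower /upper !mulmx_block !(mulmx0, mul0mx, mul1mx, mulmx1, addr0, add0r).
    rewrite mulmxBr mulmxDr mulmxBr !mulmxA.
    congr block_mx.
    - by rewrite addrA subrK.
    - rewrite !mulNmx qr !mulNmx !opprK mulmx1 mulmxDl mul1mx.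
      by rewrite [RHS]addrC addrA addrK addrC subrK.
    - by rewrite mulNmx qr opprK addrC.
  by apply: (SM) => //; apply: (SM) => //; apply: (SM) => //; apply: Sdiag.
move=> r s sr; have [r1|r1] := eqVneq (usubmx r) 0; last exact: Stop.
have [r2|r2] := eqVneq (dsubmx r) 0.
  by rewrite -[r]vsubmxK r1 r2 col_mx0 mul0mx addr0.
have [w wr] := cV_dual r2.
(* the column is in the lower half, and upper q makes its upper half nonzero *)
pose q : 'M[F]_p.+1 := (delta_mx 0 0 : 'cV_p.+1) *m w.
have UU : upper (- q) *m upper q = 1%:M.
  rewrite /upper mulmx_block !(mulmx0, mul0mx, mul1mx, mulmx1, addr0, add0r).
  by rewrite addrN -scalar_mx_block.
have -> : 1%:M + r *m s =
   upper (- q) *m (1%:M + (upper q *m r) *m (s *m upper (- q))) *m upper q.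
  rewrite mulmxDr mulmxDl mulmx1 UU !mulmxA UU mul1mx -!mulmxA UU.
  by rewrite mulmx1.
apply: (SM) => //; apply: (SM) => //; apply: Stop.
  by rewrite -mulmxA (mulmxA (upper _)) UU mul1mx.
rewrite -[r]vsubmxK /upper mul_block_col r1 mulmx0 add0r col_mxKu /q.
rewrite -mulmxA wr mulmx1; apply/eqP => /matrixP/(_ 0 0).
by rewrite !mxE !eqxx => /eqP; rewrite oner_eq0.
Qed.

(** Gaussian elimination. Once the corner entry is 1, the matrix factors as
lower * diag(1, h) * upper with [\det h = 1]. If the rest of the first row is
nonzero, a column operation produces the corner 1; otherwise the corner is
nonzero, and a column operation first makes the rest of the row nonzero. *)
Lemma transvection_generate k (S : 'M[F]_k.+1 -> Prop) :
    (forall g h, S g -> S h -> S (g *m h)) ->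
    (forall (r : 'cV_k.+1) (s : 'rV_k.+1), s *m r = 0 -> S (1%:M + r *m s)) ->
  forall g, \det g = 1 -> S g.
Proof.
elim: k S => [|k IH] S SM ST g dg.
  have := ST 0 0 (mul0mx _ _); rewrite mul0mx addr0.
  by rewrite [g]mx11_scalar -det_mx11 dg.
pose T (g : 'M[F]_(1 + k.+1)) : Prop := S g.
have TM (g1 h : 'M[F]_(1 + k.+1)) : T g1 -> T h -> T (g1 *m h) by apply: SM.
have TR (r : 'cV_(1 + k.+1)) (s : 'rV_(1 + k.+1)) : s *m r = 0 ->
    T (1%:M + r *m s) by apply: ST.
have TU w : T (upper w).
  have -> : upper w = 1%:M + col_mx 1%:M 0 *m row_mx 0 w.
    rewrite mul_col_row (scalar_mx_block 1 k.+1 1) add_block_mx.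
    by rewrite !(mul0mx, mul1mx, addr0, add0r).
  by apply: TR; rewrite mul_row_col mulmx0 mul0mx addr0.
have TL v : T (lower v).
  have -> : lower v = 1%:M + col_mx 0 v *m row_mx 1%:M 0.
    rewrite mul_col_row (scalar_mx_block 1 k.+1 1) add_block_mx.
    by rewrite !(mul0mx, mulmx0, mulmx1, mul1mx, addr0, add0r).
  by apply: TR; rewrite mul_row_col mulmx0 mul0mx addr0.
have TD h : \det h = 1 -> T (block_mx 1%:M 0 0 h).
  move: h; apply: IH => [a b Ta Tb|r s sr].
    rewrite [X in T X](_ : _ = block_mx 1%:M 0 0 a *m block_mx 1%:M 0 0 b).
      exact: TM.
    by rewrite mulmx_block !(mulmx0, mul0mx, mul1mx, addr0, add0r).
  have -> : block_mx 1%:M 0 0 (1%:M + r *m s) =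
      1%:M + col_mx (0 : 'cV_1) r *m row_mx (0 : 'rV_1) s.
    rewrite mul_col_row (scalar_mx_block 1 k.+1 1) add_block_mx.
    by rewrite !(mulmx0, mul0mx, mul1mx, addr0, add0r).
  by apply: TR; rewrite mul_row_col mulmx0 sr addr0.
have T1 (b : 'rV_k.+1) c d : \det (block_mx (1%:M : 'M[F]_1) b c d) = 1 ->
    T (block_mx 1%:M b c d).
  have -> : block_mx 1%:M b c d =
      lower c *m block_mx 1%:M 0 0 (d - c *m b) *m upper b.
    rewrite /lower /upper !mulmx_block.
    rewrite !(mulmx0, mul0mx, mul1mx, mulmx1, addr0, add0r).
    by rewrite addrC subrK.
  rewrite !det_mulmx det_lblock det_ublock det_ublock !det1 !mul1r mulr1 => dd.
  by apply: (TM) => //; apply: (TM) => //; apply: TD.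
have LL v : lower (- v) *m lower v = 1%:M :> 'M[F]_(1 + k.+1).
  rewrite /lower mulmx_block !(mulmx0, mul0mx, mul1mx, mulmx1, addr0, add0r).
  by rewrite addNr -scalar_mx_block.
have UU w : upper (- w) *m upper w = 1%:M :> 'M[F]_(1 + k.+1).
  rewrite /upper mulmx_block !(mulmx0, mul0mx, mul1mx, mulmx1, addr0, add0r).
  by rewrite addrN -scalar_mx_block.
have T2 (a : 'M[F]_1) (b : 'rV_k.+1) c d : b != 0 -> \det (block_mx a b c d) = 1 ->
    T (block_mx a b c d).
  move=> b0 dabcd; have [w wb] : exists w, b *m w = 1%:M.
    have [w wb] : exists w, w *m b^T = 1%:M by apply: cV_dual; rewrite trmx_eq0.
    by exists w^T; apply: trmx_inj; rewrite trmx_mul trmxK wb trmx1.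
  pose v := w *m (1%:M - a).
  rewrite -[block_mx _ _ _ _]mulmx1 -(LL (- v)) opprK mulmxA; apply: (TM) => //.
  rewrite [X in T X](_ : _ = block_mx 1%:M b (c + d *m v) d).
    apply: T1; move: dabcd; rewrite -[block_mx a _ _ _]mulmx1 -(LL (- v)) opprK.
    rewrite mulmxA det_mulmx det_lblock !det1 !mulr1 mulmx_block.
    rewrite !(mulmx0, mul0mx, mul1mx, mulmx1, addr0, add0r).
    by rewrite /v !mulmxA wb mul1mx addrCA subrr addr0.
  rewrite mulmx_block !(mulmx0, mul0mx, mul1mx, mulmx1, addr0, add0r).
  by rewrite /v !mulmxA wb mul1mx addrCA subrr addr0.
suff TB (a : 'M[F]_1) (b : 'rV_k.+1) c d :
    \det (block_mx a b c d) = 1 -> T (block_mx a b c d).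
  by rewrite -[g](@submxK _ 1 k.+1 1 k.+1); apply: TB; rewrite submxK.
move=> {}dg.
have [b0|] := eqVneq b 0; last by move=> b0; apply: T2.
have a0 : a != 0.
  by apply: contra_eqN dg => /eqP ->; rewrite b0 det_lblock det0 mul0r eq_sym oner_eq0.
pose w : 'rV[F]_k.+1 := delta_mx 0 0.
rewrite -[block_mx _ _ _ _]mulmx1 -(UU (- w)) opprK mulmxA; apply: (TM) => //.
have E : block_mx a b c d *m upper w = block_mx a (a *m w) c (c *m w + d).
  by rewrite mulmx_block b0 !(mulmx0, mul0mx, mul1mx, mulmx1, addr0, add0r).
rewrite E; apply: T2.
  apply: contraNneq a0 => /matrixP/(_ 0 0); rewrite !mxE big_ord1 mxE !eqxx mulr1.
  by move=> a00; rewrite [a]mx11_scalar a00 raddf0.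
by rewrite -E det_mulmx dg det_ublock !det1 !mulr1.
Qed.
End Generation.

(** * Normal form of a complex structure *)

Section NormalForm.
Variable R : realFieldType.

Lemma row_freeI (F : fieldType) m n (A : 'M[F]_(m, n)) :
  (forall u : 'rV_m, u *m A = 0 -> u = 0) -> row_free A.
Proof.
move=> A0; rewrite -kermx_eq0; apply/rowV0P => u /sub_kermxP; exact: A0.
Qed.

(** Complex linear independence. A row [v] outside the span [W] of the rows of
[E] and [E X] can be added: [W] is stable under [X], so that a relation
[a v + b v X \in W], multiplied by [a - b X], gives [(a^2 + b^2) v \in W]. *)
Lemma complex_independent N (X : 'M[R]_N) k : X *m X = - 1%:M ->
  (k + k <= N)%N -> exists E : 'M[R]_(k, N), row_free (col_mx E (E *m X)).
Proof.
move=> XX; elim: k => [|k IH] kN.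
  by exists 0; apply: row_freeI => u _; rewrite [LHS]thinmx0 [RHS]thinmx0.
have {IH}[|E] := IH; first by apply: leq_trans kN; rewrite addSn addnS !leqW.
set W := col_mx _ _ => Wfree.
have WX u : u *m W *m X = row_mx (- rsubmx u) (lsubmx u) *m W.
  rewrite -{1}[u]hsubmxK !mul_row_col mulmxDl -!mulmxA XX mulmxN mulmx1 mulNmx.
  by rewrite addrC mulmxN.
have [v vW] : exists v : 'rV_N, ~~ (v <= W)%MS.
  have : ~~ (1%:M <= W)%MS.
    rewrite sub1mx -col_leq_rank (eqP Wfree) -ltnNge.
    by apply: leq_trans kN; rewrite addSn addnS ltnW.
  by case/row_subPn => i iW; exists (row i 1%:M).
have Wker u : u *m W = 0 -> u = 0 by move=> u0; apply: (row_free_inj Wfree); rewrite u0 mul0mx.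
pose E' : 'M[R]_(k + 1, N) := col_mx E v.
suff E'free : row_free (col_mx E' (E' *m X)).
  by rewrite -(addn1 k); exists E'.
apply: row_freeI => u.
rewrite -[u]hsubmxK -[lsubmx u]hsubmxK -[rsubmx u]hsubmxK.
move: (lsubmx (lsubmx u)) (rsubmx (lsubmx u)) => u1 a'.
move: (lsubmx (rsubmx u)) (rsubmx (rsubmx u)) => u2 b' {u}.
rewrite [a']mx11_scalar [b']mx11_scalar; move: (a' 0 0) (b' 0 0) => a b {a' b'}.
rewrite /E' mul_col_mx !mul_row_col !mul_scalar_mx => u0.
have zE : a *: v + b *: (v *m X) = - (row_mx u1 u2 *m W).
  apply/eqP; rewrite -addr_eq0 mul_row_col -u0; apply/eqP.
  by rewrite addrC [RHS]addrACA.
have abv : (a ^+ 2 + b ^+ 2) *: v =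
    a *: (a *: v + b *: (v *m X)) - b *: ((a *: v + b *: (v *m X)) *m X).
  rewrite mulmxDl -!scalemxAl -mulmxA XX mulmxN mulmx1.
  by apply/matrixP => i j; rewrite !mxE; move: (\sum_ _ _) => s; ring.
have ab0 : a ^+ 2 + b ^+ 2 = 0.
  apply: contraNeq vW => ab0.
  rewrite -[v](scalerK ab0) abv zE mulNmx WX; apply: scalemx_sub.
  by rewrite addmx_sub// ?eqmx_opp scalemx_sub// eqmx_opp submxMl.
have [a0 b0] : a = 0 /\ b = 0.
  move/eqP: ab0; rewrite paddr_eq0 ?sqr_ge0// !sqrf_eq0.
  by case/andP => /eqP-> /eqP->.
move: zE; rewrite a0 b0 !scale0r addr0 => /eqP; rewrite eq_sym oppr_eq0 => /eqP.
move/Wker => u12.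
have -> : u1 = 0 by rewrite -(row_mxKl u1 u2) u12 linear0.
have -> : u2 = 0 by rewrite -(row_mxKr u1 u2) u12 linear0.
by rewrite raddf0 !row_mx0.
Qed.

Definition cplx_unit n : 'M[R]_(n + n) := block_mx 0 1%:M (- 1%:M) 0.

Lemma complex_normal_form n (X : 'M[R]_((n + n) + (n + n))) :
  X *m X = - 1%:M -> exists2 g, g \in unitmx &
  g *m X *m invmx g = block_mx (cplx_unit n) 0 0 (cplx_unit n).
Proof.
move=> XX; have [E Efree] := complex_independent XX (leqnn _).
(* half of the complex basis goes into each diagonal block *)
pose E1 := usubmx E; pose E2 := dsubmx E.
pose g := col_mx (col_mx E1 (E1 *m X)) (col_mx E2 (E2 *m X)).
have gu : g \in unitmx.
  rewrite -row_free_unit; apply: row_freeI => u.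
  rewrite -[u]hsubmxK -[lsubmx u]hsubmxK -[rsubmx u]hsubmxK.
  move: (lsubmx (lsubmx u)) (rsubmx (lsubmx u)) => a b.
  move: (lsubmx (rsubmx u)) (rsubmx (rsubmx u)) => c d {u}.
  rewrite !mul_row_col => abcd0.
  have : row_mx (row_mx a c) (row_mx b d) *m col_mx E (E *m X) = 0.
    rewrite -[E]vsubmxK mul_col_mx !mul_row_col -abcd0; exact: addrACA.
  rewrite -[RHS](mul0mx _ (col_mx E (E *m X))).
  move=> /(row_free_inj Efree) abcd.
  have := congr1 lsubmx abcd; have := congr1 rsubmx abcd.
  rewrite row_mxKl row_mxKr linear0 => bd ac.
  have := congr1 lsubmx ac; have := congr1 rsubmx ac.
  have := congr1 lsubmx bd; have := congr1 rsubmx bd.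
  by rewrite !row_mxKl !row_mxKr !linear0 => -> -> -> ->; rewrite !row_mx0.
exists g => //; apply: (canLR (mulmxK gu)).
rewrite /g /cplx_unit [RHS]mul_block_col !mul_col_mx !mul_row_col.
rewrite !mul0mx !addr0 !add0r -!mulmxA XX !mul1mx !mulNmx !mul1mx.
by rewrite !mulmxN !mulmx1.
Qed.
End NormalForm.

(** * The group of changes of basis that preserve the class of a point *)

Lemma nonroot_exists (R : numFieldType) (p : {poly R}) :
  p != 0 -> exists2 r, r != 0 & ~~ root p r.
Proof.
move=> p0; have q0 : 'X * p != 0 by rewrite mulf_neq0 ?polyX_eq0.
pose s := [seq i%:R : R | i <- iota 0 (size ('X * p))].
have : ~~ all (root ('X * p)) s.
  apply/negP => /(max_poly_roots q0); rewrite map_inj_uniq ?iota_uniq; last first.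
    by move=> i j /eqP; rewrite eqr_nat => /eqP.
  by rewrite size_map size_iota ltnn => /(_ isT).
case/allPn => r _; rewrite rootM negb_or => /andP[r0 pr]; exists r => //.
by apply: contraNneq r0 => ->; rewrite /root hornerX.
Qed.

Lemma unit_shift (R : numFieldType) p (A : 'M[R]_p) :
  exists2 r, r != 0 & A - r%:M \in unitmx.
Proof.
have [|r r0 rA] := @nonroot_exists R (char_poly A).
  by rewrite monic_neq0 ?char_poly_monic.
exists r => //; rewrite -row_free_unit -kermx_eq0.
by apply: contraNT rA; rewrite -eigenvalue_root_char.
Qed.

Lemma exists_pos_root (R : rcfType) (d : R) N : (0 < N)%N -> 0 < d ->
  exists2 c, 0 < c & c ^+ N = d.
Proof.
move=> N0 d0.
have [||c /andP[c0 _]] := @poly_ivt R ('X^N - d%:P) 0 (d + 1) _ _.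
- by rewrite addr_ge0 // ltW.
- rewrite !hornerE expr0n gtn_eqF//= sub0r oppr_le0 (ltW d0)/= subr_ge0.
  rewrite -[d in d <= _]mulr1 -(prednK N0) exprS ler_pM ?lerDl ?ler01 ?(ltW d0)//.
  by rewrite exprn_ege1// lerDr ltW.
rewrite /root !hornerE subr_eq0 => /eqP cd; exists c => //.
by rewrite lt_neqAle c0 andbT eq_sym; apply: contraTneq d0 => c00;
  rewrite -cd c00 expr0n gtn_eqF//= ltxx.
Qed.

Section Stabilizer.
Variables (R : rcfType) (eps : R).
Hypothesis eps_pts : two_conic_points eps.

Definition twistor_stab N (X g : 'M[R]_N) : Prop :=
  g \in unitmx /\ twistor_equiv eps X (g *m X *m invmx g).

Lemma invmx_mul N (g h : 'M[R]_N) : g \in unitmx -> h \in unitmx ->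
  invmx (g *m h) = invmx h *m invmx g.
Proof.
move=> gu hu; have ghu : g *m h \in unitmx by rewrite unitmx_mul gu.
rewrite -[LHS]mulmx1; apply: (canLR (mulKmx ghu)).
by rewrite -[RHS]mulmxA (mulmxA h) mulmxV// mul1mx mulmxV// mulmx1.
Qed.

Lemma twistor_stabM N (X g h : 'M[R]_N) :
  twistor_stab X g -> twistor_stab X h -> twistor_stab X (g *m h).
Proof.
move=> [gu Xg] [hu Xh]; split; first by rewrite unitmx_mul gu.
apply: rst_trans Xg _; rewrite invmx_mul//.
by have := twistor_equiv_conj gu Xh; rewrite !mulmxA.
Qed.

Lemma twistor_stab_comm N (X g : 'M[R]_N) :
  g \in unitmx -> g *m X = X *m g -> twistor_stab X g.
Proof. by move=> gu gX; split=> //; rewrite gX mulmxK//; exact: rst_refl. Qed.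

Lemma twistor_stab_conj N (X g h : 'M[R]_N) : h \in unitmx ->
  twistor_stab (h *m X *m invmx h) (h *m g *m invmx h) -> twistor_stab X g.
Proof.
move=> hu [ghu]; have hVu : invmx h \in unitmx by rewrite unitmx_inv.
have gu : g \in unitmx by move: ghu; rewrite !unitmx_mul hu hVu andbT.
have hgu : h *m g \in unitmx by rewrite unitmx_mul hu.
move/(twistor_equiv_conj hVu); rewrite invmxK !invmx_mul// invmxK.
by rewrite !mulmxA mulVmx// mul1mx !mulmxKV// mul1mx => ?; split.
Qed.

(** Conjugation of [X] by [1 + M] adds the nilpotent [- 2 X M], whose partner
in the sense of [twistor_equiv_nilpotent] is [- X L / 2]. *)
Lemma twistor_stab_nilpotent N (X M L : 'M[R]_N) :
  X *m X = - 1%:M -> M *m M = 0 -> L *m L = 0 -> M *m L + L *m M = 1%:M ->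
  X *m M + M *m X = 0 -> X *m L + L *m X = 0 -> twistor_stab X (1%:M + M).
Proof.
move=> XX MM LL ML XM XL.
have MX : M *m X = - (X *m M) by apply/eqP; rewrite -addr_eq0 addrC XM.
have LX : L *m X = - (X *m L) by apply/eqP; rewrite -addr_eq0 addrC XL.
have AB (A B : 'M[R]_N) : A *m X = - (X *m A) -> X *m A *m (X *m B) = A *m B.
  by move=> AX; rewrite mulmxA -(mulmxA X) AX mulmxN mulmxA XX !mulNmx mul1mx opprK.
have MV : (1%:M + M) *m (1%:M - M) = 1%:M.
  by rewrite mulmxDl mul1mx mulmxBr MM subr0 mulmx1 subrK.
have [Mu _] := mulmx1_unit MV; split=> //.
have -> : invmx (1%:M + M) = 1%:M - M.
  by rewrite -[LHS]mulmx1; apply: (canLR (mulKmx Mu)).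
pose N1 := (- 2) *: (X *m M); pose K := (- 2^-1) *: (X *m L).
have -> : (1%:M + M) *m X *m (1%:M - M) = X + N1.
  rewrite mulmxDl mul1mx MX mulmxBr mulmx1 mulmxBl -mulmxA MM mulmx0 subr0 /N1.
  by move: (X *m M) => U; mxlin.
apply: (twistor_equiv_nilpotent (K := K) eps_pts XX).
- by rewrite /N1 -scalemxAl -scalemxAr AB// MM !scaler0.
- by rewrite /K -scalemxAl -scalemxAr AB// LL !scaler0.
- rewrite /N1 /K -!scalemxAl -!scalemxAr !AB// !scalerA -ML.
  have -> : - 2 * - 2^-1 = 1 :> R by field.
  have -> : - 2^-1 * - 2 = 1 :> R by field.
  by rewrite !scale1r.
- by rewrite /N1 -scalemxAl -scalemxAr -scalerDr -mulmxA MX -mulmxDr subrr mulmx0 scaler0.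
- by rewrite /K -scalemxAl -scalemxAr -scalerDr -mulmxA LX -mulmxDr subrr mulmx0 scaler0.
Qed.

Section Block.
(* C0 is a complex conjugation for the complex structure I0. *)
Variables (p : nat) (I0 C0 : 'M[R]_p.+1).
Hypotheses (II : I0 *m I0 = - 1%:M) (CC : C0 *m C0 = 1%:M)
  (IC : I0 *m C0 + C0 *m I0 = 0).
Let X0 : 'M[R]_(p.+1 + p.+1) := block_mx I0 0 0 I0.

Let XX0 : X0 *m X0 = - 1%:M.
Proof.
rewrite mulmx_block !(mulmx0, mul0mx, addr0, add0r) II.
by rewrite (scalar_mx_block p.+1 p.+1 1) opp_block_mx oppr0.
Qed.

Lemma upperD (P Q : 'M[R]_p.+1) : upper (P + Q) = upper P *m upper Q.
Proof.
rewrite /upper mulmx_block !(mulmx0, mul0mx, mul1mx, mulmx1, addr0, add0r).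
by rewrite addrC.
Qed.

(** The nilpotent matrix with the single block [P] has the one with the opposite
block [P^-1] as its partner. *)
Lemma stab_upper_antilinear_unit (P : 'M[R]_p.+1) : P \in unitmx ->
  I0 *m P + P *m I0 = 0 -> twistor_stab X0 (upper P).
Proof.
move=> Pu IP.
have PV : I0 *m invmx P + invmx P *m I0 = 0.
  have : invmx P *m (I0 *m P + P *m I0) *m invmx P = 0.
    by rewrite IP mulmx0 mul0mx.
  by rewrite mulmxDr mulmxDl !mulmxA mulVmx// mul1mx mulmxK// addrC.
have -> : upper P = 1%:M + block_mx 0 P 0 0.
  by rewrite (scalar_mx_block p.+1 p.+1 1) add_block_mx !(addr0, add0r).
apply: (@twistor_stab_nilpotent _ _ _ (block_mx 0 0 (invmx P) 0)) => //;
  rewrite ?(mulmx_block, mulmx0, mul0mx, addr0, add0r, block_mx0, add_block_mx) ?IP ?PV//.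
- by rewrite mulmxV// mulVmx// -scalar_mx_block.
- by rewrite block_mx0.
- by rewrite block_mx0.
Qed.

(** An antilinear [P] is a sum of two invertible ones, [P - r C0] and [r C0],
when [r != 0] is not an eigenvalue of [P C0]. *)
Lemma stab_upper_antilinear (P : 'M[R]_p.+1) :
  I0 *m P + P *m I0 = 0 -> twistor_stab X0 (upper P).
Proof.
move=> IP; have Cu : C0 \in unitmx by case: (mulmx1_unit CC).
have [r r0 ru] := unit_shift (P *m C0).
have -> : P = (P - r *: C0) + r *: C0 by rewrite subrK.
have IrC : I0 *m (r *: C0) + r *: C0 *m I0 = 0.
  by rewrite -scalemxAl -scalemxAr -scalerDr IC scaler0.
rewrite upperD; apply: twistor_stabM; apply: stab_upper_antilinear_unit => //.
- have -> : P - r *: C0 = (P *m C0 - r%:M) *m C0.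
    by rewrite mulmxBl -mulmxA CC mulmx1 mul_scalar_mx.
  by rewrite unitmx_mul ru.
- rewrite mulmxBr mulmxBl addrACA IP -opprD IrC subr0 //.
- by rewrite unitmxZ ?unitfE.
Qed.

(** [P] splits into its complex linear part, which commutes with [X0], and its
antilinear part. *)
Lemma stab_upper (P : 'M[R]_p.+1) : twistor_stab X0 (upper P).
Proof.
pose A := 2^-1 *: (P - I0 *m P *m I0); pose B := 2^-1 *: (P + I0 *m P *m I0).
have -> : P = A + B.
  by rewrite /A /B; apply/matrixP => i j; rewrite !mxE; move: (\sum_ _ _) => s; field.
have IIM (M : 'M[R]_p.+1) : I0 *m (I0 *m M) = - M by rewrite mulmxA II mulNmx mul1mx.
have MII (M : 'M[R]_p.+1) : M *m I0 *m I0 = - M by rewrite -mulmxA II mulmxN mulmx1.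
rewrite upperD; apply: twistor_stabM.
  apply: twistor_stab_comm.
    have : upper A *m upper (- A) = 1%:M.
      rewrite -upperD subrr /upper; by rewrite -scalar_mx_block.
    by case/mulmx1_unit.
  rewrite /upper /X0 !mulmx_block !(mulmx0, mul0mx, mul1mx, mulmx1, addr0, add0r).
  congr block_mx; rewrite /A -scalemxAl -scalemxAr mulmxBr mulmxBl -!mulmxA IIM.
  by rewrite II !mulmxA mulmxN mulmx1 !opprK addrC.
apply: stab_upper_antilinear.
rewrite /B -scalemxAl -scalemxAr -scalerDr mulmxDr mulmxDl MII -!mulmxA IIM.
by rewrite addrA subrK subrr scaler0.
Qed.

Lemma stab_lower (P : 'M[R]_p.+1) : twistor_stab X0 (lower P).
Proof.
(* the exchange of the two blocks commutes with X0 *)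
pose w : 'M[R]_(p.+1 + p.+1) := block_mx 0 1%:M 1%:M 0.
have ww : w *m w = 1%:M.
  by rewrite mulmx_block !(mulmx0, mul0mx, mulmx1, addr0, add0r) -scalar_mx_block.
have wS : twistor_stab X0 w.
  apply: twistor_stab_comm; first by case: (mulmx1_unit ww).
  by rewrite !mulmx_block !(mulmx0, mul0mx, mul1mx, mulmx1, addr0, add0r).
have -> : lower P = w *m upper P *m w.
  by rewrite /lower /upper !mulmx_block !(mulmx0, mul0mx, mul1mx, mulmx1, addr0, add0r).
by apply: twistor_stabM => //; apply: twistor_stabM => //; apply: stab_upper.
Qed.

Lemma stab_det_gt0 (g : 'M[R]_(p.+1 + p.+1)) : 0 < \det g -> twistor_stab X0 g.
Proof.
move=> dg; have [c c0 cN] := @exists_pos_root R (\det g) (p.+1 + p.+1) isT dg.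
have cU : (c%:M : 'M[R]_(p.+1 + p.+1)) \in unitmx.
  by rewrite unitmxE det_scalar unitfE expf_neq0 ?gt_eqF.
have -> : g = c%:M *m (c^-1 *: g).
  by rewrite mul_scalar_mx scalerA mulfV ?gt_eqF// scale1r.
apply: twistor_stabM; first by apply: twistor_stab_comm => //; rewrite scalar_mxC.
apply: (@transvection_generate R _ (twistor_stab X0)).
- by move=> *; apply: twistor_stabM.
- apply: upper_lower_transvection; [|exact: stab_upper|exact: stab_lower].
  by move=> *; apply: twistor_stabM.
- by rewrite detZ exprVn cN mulVf ?gt_eqF.
Qed.

End Block.

Definition cplx_conj n : 'M[R]_(n + n) := block_mx 1%:M 0 0 (- 1%:M).

Lemma cplx_unit_sqr n : cplx_unit R n *m cplx_unit R n = - 1%:M.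
Proof.
rewrite /cplx_unit mulmx_block !(mulmx0, mul0mx, mul1mx, mulmx1, addr0, add0r).
by rewrite (scalar_mx_block n n 1) opp_block_mx oppr0.
Qed.

Lemma cplx_conj_sqr n : cplx_conj n *m cplx_conj n = 1%:M.
Proof.
rewrite mulmx_block !(mulmx0, mul0mx, mul1mx, mulmx1, addr0, add0r).
by rewrite mulNmx mul1mx opprK -scalar_mx_block.
Qed.

Lemma cplx_unit_conj n :
  cplx_unit R n *m cplx_conj n + cplx_conj n *m cplx_unit R n = 0.
Proof.
rewrite /cplx_unit !mulmx_block !(mulmx0, mul0mx, mul1mx, mulmx1, addr0, add0r).
by rewrite add_block_mx !mulmxN !mulmx1 opprK !addNr !addr0 block_mx0.
Qed.

(** There is a twistor line through every point: in the normal form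
[diag(I, I)], the matrix [[0, eps C], [C, 0]] anticommutes with it and has
square [eps], [C] being the complex conjugation. *)
Lemma twistor_step_refl N n (X : 'M[R]_N) : N = ((n + n) + (n + n))%N ->
  X *m X = - 1%:M -> twistor_step eps X X.
Proof.
move=> NE; move: X; rewrite {N}NE => X XX.
have [h hu hX] := complex_normal_form XX.
have -> : X = invmx h *m block_mx (cplx_unit R n) 0 0 (cplx_unit R n) *m
             invmx (invmx h).
  by rewrite -hX invmxK !mulmxA mulVmx// mul1mx mulmxKV.
apply: twistor_step_conj; first by rewrite unitmx_inv.
exists (block_mx 0 (eps *: cplx_conj n) (cplx_conj n) 0), 1, 0; split.
- rewrite mulmx_block !(mulmx0, mul0mx, addr0, add0r) cplx_unit_sqr.
  by rewrite (scalar_mx_block (n + n) (n + n) 1) opp_block_mx oppr0.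
- rewrite mulmx_block !(mulmx0, mul0mx, addr0, add0r) -scalemxAl -scalemxAr.
  by rewrite cplx_conj_sqr scalemx1 -scalar_mx_block.
- have := cplx_unit_conj n; move: (cplx_unit R n) (cplx_conj n) => I0 C0 IC.
  rewrite !mulmx_block !(mulmx0, mul0mx, addr0, add0r) -scalemxAl -scalemxAr.
  by rewrite add_block_mx -scalerDr IC scaler0 !addr0 block_mx0.
- by rewrite scale1r scale0r addr0.
- by rewrite expr1n expr0n mulr0 subr0.
Qed.

(** The local statement: [g = 1 - Y X] conjugates [X] into [Y], as
[g X = X + Y = Y g]. *)
Lemma twistor_equiv_det N n (X Y : 'M[R]_N) :
  N = ((n.+1 + n.+1) + (n.+1 + n.+1))%N ->
  X *m X = - 1%:M -> Y *m Y = - 1%:M -> 0 < \det (1%:M - Y *m X) ->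
  twistor_equiv eps X Y.
Proof.
move=> NE; move: X Y; rewrite {N}NE => X Y XX YY dYX.
have [h hu hX] := complex_normal_form XX.
pose g := 1%:M - Y *m X.
suff [gu] : twistor_stab X g.
  have -> : g *m X *m invmx g = Y => //.
  apply: (canLR (mulmxK gu)); rewrite /g mulmxBl mulmxBr mul1mx mulmx1 -mulmxA XX.
  by rewrite mulmxA YY mulmxN mulmx1 mulNmx mul1mx !opprK addrC.
apply: (twistor_stab_conj hu); rewrite hX.
have II : cplx_unit R n.+1 *m cplx_unit R n.+1 = - 1%:M := cplx_unit_sqr _.
have CC : cplx_conj n.+1 *m cplx_conj n.+1 = 1%:M := cplx_conj_sqr _.
have IC : cplx_unit R n.+1 *m cplx_conj n.+1 + cplx_conj n.+1 *m cplx_unit R n.+1 = 0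
  := cplx_unit_conj _.
apply: (stab_det_gt0 II CC IC).
by rewrite !det_mulmx mulrAC -det_mulmx mulmxV// det1 mul1r.
Qed.

End Stabilizer.

(** * Continuity of matrix-valued functions *)

Section MatrixContinuity.
Variables (R : realType) (T : topologicalType).

Lemma continuous_mx m n (f : T -> 'M[R]_(m, n)) :
  (forall i j, continuous (fun t => f t i j)) -> continuous f.
Proof.
move=> fc t A [P ftP PA].
have : \forall x \near t, forall ij : 'I_m * 'I_n, P ij.1 ij.2 (f x ij.1 ij.2).
  by apply: filter_forall => -[i j]; apply: fc; exact: ftP.
by apply: filterS => x Px; apply: PA => i j; exact: (Px (i, j)).
Qed.

Lemma continuous_sum (I : Type) (r : seq I) (P : pred I) (F : I -> T -> R) :
  (forall i, continuous (F i)) -> continuous (fun t => \sum_(i <- r | P i) F i t).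
Proof.
move=> Fc; elim: r => [|i r IH] t.
  by under eq_fun do rewrite big_nil; exact: cvg_cst.
under eq_fun do rewrite big_cons; case: (P i); last exact: IH.
by apply: cvgD; [exact: Fc|exact: IH].
Qed.

Lemma continuous_prod (I : Type) (r : seq I) (P : pred I) (F : I -> T -> R) :
  (forall i, continuous (F i)) -> continuous (fun t => \prod_(i <- r | P i) F i t).
Proof.
move=> Fc; elim: r => [|i r IH] t.
  by under eq_fun do rewrite big_nil; exact: cvg_cst.
under eq_fun do rewrite big_cons; case: (P i); last exact: IH.
by apply: cvgM; [exact: Fc|exact: IH].
Qed.

Lemma continuous_det n (f : T -> 'M[R]_n) :
  (forall i j, continuous (fun t => f t i j)) -> continuous (fun t => \det (f t)).
Proof.
move=> fc; apply: continuous_sum => s t; apply: cvgM; first exact: cvg_cst.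
by apply: continuous_prod.
Qed.

Lemma continuous_det_sub_mul n (f : T -> 'M[R]_n) (A : 'M[R]_n) :
  (forall i j, continuous (fun t => f t i j)) ->
  continuous (fun t => \det (1%:M - f t *m A)).
Proof.
move=> fc; apply: continuous_det => i j t.
have -> : (fun t => (1%:M - f t *m A) i j) =
    (fun t => (1%:M : 'M[R]_n) i j - \sum_k f t i k * A k j).
  by apply/funext => u; rewrite !mxE.
apply: cvgB; first exact: cvg_cst.
by apply: continuous_sum => k u; apply: cvgM; [exact: fc|exact: cvg_cst].
Qed.
End MatrixContinuity.

(** * From matrices to endomorphisms *)

Section Transfer.
Variables (R : realType) (V : vectType R) (eps : R).
Local Notation b := (vbasis (fullv : {vspace V})).
Local Notation mx := (mxof b b).
Local Notation hom := (hommx b b).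
Let bP : basis_of fullv b := vbasisP _.

Lemma ComplE (x : 'End(V)) : Compl V x <-> mx x *m mx x = - 1%:M.
Proof.
rewrite -mxof_comp// -(@mxof1 _ _ b) ?(basis_free bP)// -(raddfN (mxof b b)).
split => [-> //|/(can_inj (mxofK bP bP))//].
Qed.

Section Representation.
Variables X J : 'M[R]_(\dim {:V}).
Hypotheses (XX : X *m X = - 1%:M) (JJ : J *m J = eps%:M)
  (XJ : X *m J + J *m X = 0) (eps0 : eps != 0) (V0 : \dim {:V} != 0%N).

(** Matrices act on rows, so that [hommx] reverses products: the image of
[i j] is the composite of the endomorphisms of [X] and [J], in this order, and its
matrix is [J *m X]. *)
Definition H_mx (q : H eps) : 'M[R]_(\dim {:V}) :=
  hre q *: 1%:M + hi q *: X + hj q *: J + hij q *: (J *m X).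

Definition H_rep q : 'End(V) := hom (H_mx q).

Lemma H_mxM p q : H_mx (p * q) = H_mx q *m H_mx p.
Proof.
have XJ' : X *m J = - (J *m X) by apply/eqP; rewrite -addr_eq0 XJ.
pose K := J *m X.
have XK : X *m K = J by rewrite mulmxA XJ' mulNmx -mulmxA XX mulmxN mulmx1 opprK.
have JK : J *m K = eps *: X by rewrite mulmxA JJ mul_scalar_mx.
have KX : K *m X = - J by rewrite -mulmxA XX mulmxN mulmx1.
have KJ : K *m J = - (eps *: X) by rewrite -mulmxA XJ' mulmxN JK.
have KK : K *m K = eps%:M.
  by rewrite /K -mulmxA XK.
rewrite /H_mx -/K !mulmxDr !mulmxDl -!scalemxAl -!scalemxAr !mul1mx !mulmx1.
rewrite XX JJ XJ' -/K XK JK KX KJ KK -[eps%:M]scalemx1.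
move: K {XK JK KX KJ KK} => K; case: p q => a b c d [a' b' c' d'] /=.
by mxlin.
Qed.

Lemma H_rep_faithful : faithful_representation H_rep.
Proof.
split.
- move=> a p q; rewrite /H_rep /H_mx -linearP; congr (hom _).
  by case: p q => ? ? ? ? [? ? ? ?] /=; move: (J *m X) => K; mxlin.
- by rewrite /H_rep /H_mx /= scale1r !scale0r !addr0 hommx1.
- by move=> p q; rewrite /H_rep H_mxM (hommx_mul bP bP bP).
- move=> p q /(can_inj (hommxK bP bP)) pq.
  (* X is not a scalar, because - 1 is not a square *)
  have sgl (u v : R) : u *: X = v%:M -> u = 0 /\ v = 0.
    move=> uv; have uuvv : (u ^+ 2 + v ^+ 2) *: (1%:M : 'M[R]_(\dim {:V})) = 0.
      rewrite scalerDl -[u ^+ 2 *: _]opprK -scalerN -XX.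
      rewrite (_ : _ *: (X *m X) = (u *: X) *m (u *: X)); last first.
        by rewrite -scalemxAl -scalemxAr scalerA.
      by rewrite uv mul_scalar_mx !scale_scalar_mx mulr1 -expr2 addNr.
    have : u ^+ 2 + v ^+ 2 = 0.
      move/matrixP: uuvv; have := V0; rewrite -lt0n.
      case: (\dim {:V}) => // d _ /(_ 0 0); rewrite !mxE eqxx mulr1 => ->//.
    move/eqP; rewrite paddr_eq0 ?sqr_ge0// !sqrf_eq0.
    by case/andP => /eqP-> /eqP->.
  have D0 : H_mx p - H_mx q = 0 by rewrite pq subrr.
  (* for D = H_mx p - H_mx q, D - X D X and D + X D X isolate the
     terms in 1, X and those in J, J X *)
  have [D1 D2] : (hi p - hi q) *: X = (hre q - hre p)%:M /\
     J *m ((hij p - hij q) *: X - (hj q - hj p)%:M) = 0.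
    have XJ' : X *m J = - (J *m X) by apply/eqP; rewrite -addr_eq0 XJ.
    have D0' : X *m (H_mx p - H_mx q) *m X = 0 by rewrite D0 mulmx0 mul0mx.
    have XKX : X *m (J *m X) *m X = J *m X.
      by rewrite -!mulmxA XX mulmxN mulmx1 mulmxN XJ' opprK.
    have XJX : X *m J *m X = J by rewrite XJ' mulNmx -mulmxA XX mulmxN mulmx1 opprK.
    have D1 : 2^-1 *: ((H_mx p - H_mx q) - X *m (H_mx p - H_mx q) *m X) = 0.
      by rewrite D0' D0 subr0 scaler0.
    have D2 : 2^-1 *: ((H_mx p - H_mx q) + X *m (H_mx p - H_mx q) *m X) = 0.
      by rewrite D0' D0 addr0 scaler0.
    have XDX : X *m (H_mx p - H_mx q) *m X =
        - ((hre p - hre q)*: 1%:M) - (hi p - hi q) *: X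
        + (hj p - hj q) *: J + (hij p - hij q) *: (J *m X).
      rewrite /H_mx !(mulmxBr, mulmxBl, mulmxDr, mulmxDl) -!scalemxAr -!scalemxAl.
      rewrite XKX XJX mulmx1 XX mulNmx mul1mx.
      by move: (J *m X) => K; mxlin.
    split.
      rewrite -[RHS]addr0 -D1 XDX /H_mx -[_%:M]scalemx1; move: (J *m X) => K.
      by apply/matrixP => i j; rewrite !mxE; field.
    rewrite -[RHS]D2 XDX /H_mx mulmxBr -scalemxAr -[_%:M]scalemx1 -scalemxAr mulmx1.
    move: (J *m X) => K.
    by apply/matrixP => i j; rewrite !mxE; field.
  have [ie re] := sgl _ _ D1.
  have [ke je] : hij p - hij q = 0 /\ hj q - hj p = 0.
    apply: sgl; apply/eqP; rewrite -subr_eq0; apply/eqP.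
    have := congr1 (mulmx J) D2; rewrite mulmxA JJ mul_scalar_mx mulmx0.
    by move/eqP; rewrite scaler_eq0 (negPf eps0) => /eqP.
  case: p q ie re ke je {pq D0 D1 D2} => a b c d [a' b' c' d'] /=.
  by do 4 ![move/eqP; rewrite subr_eq0 => /eqP ->].
Qed.

End Representation.

Hypotheses (eps0 : eps != 0) (V0 : \dim {:V} != 0%N).

Definition share_component (x y : 'End(V)) : Prop :=
  exists2 C, twistor_line_component eps C & C x /\ C y.

(** The arc [sqrt (1 + t^2 (a^2 - 1)) X + t c J], [0 <= t <= 1], runs inside
the twistor line from [X] to [a X + c J]; its end is correct because [0 <= a]. *)
Lemma twistor_step_share X Y :
  twistor_step eps X Y -> share_component (hom X) (hom Y).
Proof.
case=> J [a [c [XX JJ XJ -> [ac a0]]]].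
pose rho := H_rep X J; pose S := rho @` imaginary_units eps.
have linS : twistor_line eps S.
  by exists rho => //; exact: (H_rep_faithful XX JJ XJ eps0 V0).
pose alpha (t : R) := Num.sqrt (1 + t ^+ 2 * (a ^+ 2 - 1)).
pose M (t : R) : 'M[R]_(\dim {:V}) := alpha t *: X + (t * c) *: J.
have M0 : M 0 = X.
  by rewrite /M /alpha expr0n !mul0r addr0 sqrtr1 scale1r scale0r addr0.
have M1 : M 1 = a *: X + c *: J.
  by rewrite /M /alpha expr1n !mul1r (addrC 1) subrK sqrtr_sqr ger0_norm.
have SM t : `[0, 1]%classic t -> S (hom (M t)).
  rewrite /= in_itv/= => /andP[t0 t1].
  exists (mkH 0 (alpha t) (t * c) 0); last first.
    by rewrite /rho /H_rep /H_mx /= !scale0r add0r addr0.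
  have alpha2 : alpha t ^+ 2 = 1 + t ^+ 2 * (a ^+ 2 - 1).
    rewrite sqr_sqrtr// (_ : _ + _ = (1 - t ^+ 2) + t ^+ 2 * a ^+ 2); last by ring.
    by rewrite addr_ge0 ?subr_ge0 ?expr_le1// mulr_ge0 ?sqr_ge0.
  have epsc : eps * c ^+ 2 = a ^+ 2 - 1 by rewrite -ac; ring.
  congr mkH => /=.
  - rewrite mulr0 sub0r mulr0 addr0 -expr2 alpha2 -epsc; ring.
  - by ring.
  - by ring.
  - by ring.
have alphac : continuous alpha.
  move=> t; rewrite /alpha.
  apply: (@cvg_comp _ _ _ (fun t => 1 + t ^+ 2 * (a ^+ 2 - 1)) (@Num.sqrt R));
    last exact: sqrt_continuous.
  apply: cvgD; first exact: cvg_cst.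
  by apply: cvgM; [exact: exprn_continuous|exact: cvg_cst].
have Mc : continuous M.
  apply: continuous_mx => i j t.
  under eq_fun do rewrite !mxE.
  apply: cvgD; apply: cvgM; try exact: cvg_cst; last first.
    by apply: cvgM; [exact: cvg_id|exact: cvg_cst].
  exact: alphac.
have Mhc : continuous (fun t => hom (M t)).
  apply: continuous_comp_initial => t; rewrite /comp.
  by under eq_fun do rewrite (hommxK bP bP); exact: Mc.
exists (connected_component S (hom X)).
  exists S; split => //; exists (hom X) => //.
  by rewrite -M0; apply: SM; rewrite /= in_itv/= lexx ler01.
split.
  apply: connected_component_refl.
  by rewrite -M0; apply: SM; rewrite /= in_itv/= lexx ler01.
exists ((fun t => hom (M t)) @` `[0, 1]%classic).
  split.
  - by exists 0; rewrite ?M0//= in_itv/= lexx ler01.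
  - by move=> _ [t t01 <-]; exact: SM.
  - apply: connected_continuous_connected; first exact: segment_connected.
    exact: continuous_subspaceT.
by exists 1; rewrite ?M1//= in_itv/= lexx ler01.
Qed.

Lemma H_path_cons x y z : share_component x y -> H_path V eps y z ->
  H_path V eps x z.
Proof.
move=> [C0 C0comp [C0x C0y]] [m [C [Ccomp Cy Cz CC]]].
exists m.+1, (fun l => if l is l'.+1 then C l' else C0); split => //.
- by case=> // l lm; apply: Ccomp.
- by case=> [_|l lm]; [exists y|exact: CC].
Qed.

Lemma H_path_equiv X Y :
  (forall Z : 'M[R]_(\dim {:V}), Z *m Z = - 1%:M -> twistor_step eps Z Z) ->
  Y *m Y = - 1%:M ->
  twistor_equiv eps X Y -> H_path V eps (hom X) (hom Y).
Proof.
move=> refl + /clos_rst_rst1n_iff XY; elim: XY => {X Y} [X XX|X Z Y XZ _ + YY].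
  have [C Ccomp [CX _]] := twistor_step_share (refl X XX).
  by exists 0%N, (fun=> C); split.
move=> /(_ YY); apply: H_path_cons.
case: XZ => /twistor_step_share // [C Ccomp [CZ CX]].
by exists C.
Qed.

Lemma open_det_gt0 (z : 'End(V)) :
  open [set y : 'End(V) | 0 < \det (1%:M - mx y *m mx z)].
Proof.
have mxc i j : continuous (fun y : 'End(V) => mx y i j).
  move=> y; apply: (@cvg_comp _ _ _ (mxof b b) (fun M : 'M[R]_(_, _) => M i j)).
    exact: initial_continuous.
  exact: coord_continuous.
have dc := continuous_det_sub_mul mxc (A := mx z).
by move/continuousP : dc => /(_ _ (@open_gt R 0)).
Qed.

(* twistor_equiv_det provides this: a class contains a neighbourhood, within
   Compl, of each of its points. *)
Hypothesis local : forall X Y : 'M[R]_(\dim {:V}),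
  X *m X = - 1%:M -> Y *m Y = - 1%:M -> 0 < \det (1%:M - Y *m X) ->
  twistor_equiv eps X Y.

(** Within the component [K], a class is a union of open sets [U z], and so is
its complement; as [K] is connected, the class of [x] is all of [K]. *)
Lemma connected_component_equiv (x y : 'End(V)) : Compl V x ->
  connected_component (Compl V) x y -> twistor_equiv eps (mx x) (mx y).
Proof.
move=> Cx Kxy; pose K := connected_component (Compl V) x.
have KC : K `<=` Compl V by exact: connected_component_sub.
pose B := K `&` [set y | twistor_equiv eps (mx x) (mx y)].
pose U z := [set y : 'End(V) | 0 < \det (1%:M - mx y *m mx z)].
have UE z w : K z -> K w -> U z w -> twistor_equiv eps (mx z) (mx w).
  by move=> /KC/ComplE zz /KC/ComplE ww; exact: local.
have UU z : K z -> U z z.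
  move=> /KC/ComplE zz; rewrite /U /= zz opprK -[_ + _](raddfD (@scalar_mx R _)).
  by rewrite det_scalar exprn_gt0// addr_gt0.
suff BK : B = K by have [] : B y by rewrite BK.
apply: component_connected.
- exists x; split; first exact: connected_component_refl.
  exact: rst_refl.
- exists (\bigcup_(z in B) U z).
    by apply: bigcup_open => z _; exact: open_det_gt0.
  apply/seteqP; split => [z Bz|z [Kz [w [Kw xw] wz]]].
    by split; [case: Bz|exists z => //; apply: UU; case: Bz].
  by split => //; apply: rst_trans xw _; exact: UE.
- exists (~` \bigcup_(z in K `\` B) U z).
    by rewrite closedC; apply: bigcup_open => z _; exact: open_det_gt0.
  apply/seteqP; split => [z [Kz xz]|z [Kz nz]].
    split => // -[w [Kw nBw] wz]; apply: nBw; split => //.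
    by apply: rst_trans xz _; apply: rst_sym; exact: UE.
  split => //; apply: contrapT => nxz; apply: nz; exists z; last exact: UU.
  by split => // -[].
Qed.
End Transfer.

(** * The theorem *)

Theorem theorem1p3 (R : realType) (V : vectType R) (n : nat)
    (hn : (1 <= n)%N) (hV : \dim {:V} = (4 * n)%N) :
  H_connected V (-1) /\ H_connected V 1.
Proof.
have dimE : \dim {:V} = ((n.-1.+1 + n.-1.+1) + (n.-1.+1 + n.-1.+1))%N.
  by rewrite prednK// hV !addnn -!mul2n mulnA.
have V0 : \dim {:V} != 0%N by rewrite dimE.
suff H (eps : R) : eps != 0 -> two_conic_points eps ->
  H_connected V eps.
  split.
    (* rational points of the circle *)
    apply: (H (-1)); first by rewrite oppr_eq0 oner_eq0.
    exists (3 / 5), (4 / 5), (4 / 5), (3 / 5).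
    split; [rewrite gt_eqF//; lra|rewrite gt_eqF//; lra|rewrite lt_eqF//; lra|
      by split; lra|by split; field].
  (* rational points of the hyperbola *)
  apply: (H 1); first by rewrite oner_eq0.
  exists (5 / 4), (3 / 4), (5 / 3), (4 / 3).
  split; [rewrite gt_eqF//; lra|rewrite gt_eqF//; lra|rewrite lt_eqF//; lra|
      by split; lra|by split; field].
move=> eps0 pts x y Cx Cy xy.
have local X Y := twistor_equiv_det pts (X := X) (Y := Y) dimE.
have bP : basis_of fullv (vbasis (fullv : {vspace V})) := vbasisP _.
rewrite -[x](mxofK bP bP) -[y](mxofK bP bP).
apply: H_path_equiv => //.
- by move=> Z; exact: twistor_step_refl dimE.
- exact/ComplE.
- exact: connected_component_equiv.
Qed.
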